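(* There is an absolute constant $c>0$ such that for every fixed positive integer $k$ and every $\varepsilon>0$ there exist constants $C=C(k,\varepsilon)>0$ and $C'=C'(k,\varepsilon)>0$ with the following property. For every prime $p$ and every interval $I\subset\mathbb{F}_p\setminus\{0\}$ with $|I|<p^{c/k^2}$, the number $J_{2k}$ of solutions of $$x_1^{-1}+\dots+x_k^{-1}=x_{k+1}^{-1}+\dots+x_{2k}^{-1}\quad\text{in }\mathbb{F}_p,\qquad x_1,\dots,x_{2k}\in I,$$ satisfies $$J_{2k}<C\,|I|^{k+\varepsilon}.$$ In particular, for such intervals $I$, $$|k(I^{-1})|>C'\,|I|^{k-\varepsilon}.$$
   Context: $\mathbb{F}_p$ is the field of residue classes modulo the prime $p$; $x^{-1}$ is the inverse in $\mathbb{F}_p$. An interval $I$ in $\mathbb{F}_p$ is a non-empty set of residue classes of consecutive integers $M+1,\dots,M+N$ with $1\le N\le p$, and $|I|=N$. Here $k(I^{-1})=\{x_1^{-1}+\dots+x_k^{-1}: x_1,\dots,x_k\in I\}\subset\mathbb{F}_p$. *)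

(* Defs.v *)
From mathcomp Require Import all_boot all_order all_algebra.

Set Implicit Arguments.
Unset Strict Implicit.
Unset Printing Implicit Defensive.

Import GRing.Theory.
Local Open Scope ring_scope.

(* The type 'F_p is the field of residue classes mod p only when p is prime; every
   definition below is meant to be used under that hypothesis. *)

(* I consists of the classes of M + 1, ..., M + N with 1 <= N <= p. The bound
   N <= p makes these classes distinct, so that #|I| = N. *)
Definition Fp_interval (p : nat) (I : {set 'F_p}) : Prop :=
  exists (M : int) (N : nat),
    (1 <= N <= p)%N /\ I = [set (M + i.+1%:Z)%:~R | i : 'I_N].

(* x_1, ..., x_k are the coordinates [lshift k i] of x, and x_(k+1), ...,
   x_(2k) the coordinates [rshift k i]. *)
Definition J2k_sols (p k : nat) (I : {set 'F_p}) :
    {set {ffun 'I_(k + k) -> 'F_p}} :=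
  [set x in ffun_on (mem I) |
    \sum_(i < k) (x (lshift k i))^-1 == \sum_(i < k) (x (rshift k i))^-1].

Definition J2k (p k : nat) (I : {set 'F_p}) : nat := #|J2k_sols k I|.

Definition inv_sumset (p k : nat) (I : {set 'F_p}) : {set 'F_p} :=
  [set \sum_(i < k) (x i)^-1 | x : {ffun 'I_k -> 'F_p} in ffun_on (mem I)].

(* Main.v *)
Require Import Defs.
From mathcomp Require Import all_boot all_order all_algebra.
From mathcomp Require Import perm all_field zify ring.
From mathcomp Require Import reals exp.

(** Let [I] be [M + 1, ..., M + N], put [n = 2k] and let [x_1, ..., x_n] be the
    offsets of a solution. Clearing denominators, the solution says that
    [- (M + 1)] is a root mod [p] of an integer polynomial of degree less than
    [n] with coefficients bounded by a power of [N]. As [N ^ (32 k^2) < p], the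
    resultants of these polynomials are smaller than [p], hence zero; so each
    of them has a root in common with a fixed one, and up to a factor [n] it
    suffices to count the solutions whose polynomial is divisible by a given
    primitive polynomial [f], of degree [d] say.

    For an unrepeated entry [x] of such a solution, Gauss's lemma shows that
    [f(x)] divides the [d]-th power of the least common multiple of the
    differences [y - x], [y] running over the other entries that do not cancel
    out. With [g(y, x) := gcd (f(y), y - x)], the lcm of the [g(y, x)] is
    thus at least [|f(x)| ^ (1 / d)], which has order [N] or more for most [x].
    Now choose the entries of the tuple one after another. The earlier entries
    [y] leave [N ^ o(1)] choices for the divisors [g(y, x)] of [f(y)], and then
    restrict [x] to a residue class modulo their lcm. Reading the tuple
    forwards and backwards, the two moduli obtained for [x] have product at
    least [|f(x)| ^ (1 / d)], so that in one of the two directions the number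
    of choices is on average only [N ^ (1/2 + o(1))] for each entry, which gives
    [N ^ (n/2 + o(1))] tuples. The second inequality is Cauchy-Schwarz. *)

Set Implicit Arguments.
Unset Strict Implicit.
Unset Printing Implicit Defensive.

Import Order.TTheory GRing.Theory Num.Theory.

(** * The divisor bound *)

Local Open Scope nat_scope.

Lemma size_divisors_pfactor (p n : nat) : prime p -> 0 < n ->
  size (divisors n) <= (logn p n).+1 * size (divisors n`_p^').
Proof.
move=> p_pr n0.
have n'0 : 0 < n`_p^' by apply: part_gt0.
pose s := [seq p ^ i * e | i <- iota 0 (logn p n).+1, e <- divisors n`_p^'].
have -> : (logn p n).+1 * size (divisors n`_p^') = size s.
  by rewrite size_allpairs size_iota.
apply: uniq_leq_size; first exact: divisors_uniq.
move=> d; rewrite -dvdn_divisors // => dn.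
have d0 : 0 < d by apply: dvdn_gt0 dn.
rewrite -(partnC p d0) p_part; apply: allpairs_f.
  by rewrite mem_iota add0n ltnS; apply: dvdn_leq_log.
by rewrite -dvdn_divisors //; apply: partn_dvd.
Qed.

(** Pays for the primes below [2 ^ m]: with [j = a %/ m], [a + 1 <= m (j + 1)] and
    [j + 1 <= 2 ^ j]. *)
Lemma succ_exp_bound (m a : nat) : 0 < m -> a.+1 ^ m <= m ^ m * 2 ^ a.
Proof.
move=> m0.
have h : a.+1 <= m * (a %/ m).+1.
  by rewrite mulnC; have := ltn_ceil a m0; lia.
apply: leq_trans (_ : (m * (a %/ m).+1) ^ m <= _); first by rewrite leq_exp2r.
rewrite expnMn leq_mul2l; apply/orP; right.
apply: leq_trans (_ : (2 ^ (a %/ m)) ^ m <= _).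
  by rewrite leq_exp2r //; apply: ltn_expl.
by rewrite -expnM leq_exp2l //; apply: leq_divM.
Qed.

(** Strip off the smallest prime [p], of exponent [a]: it contributes at most [(a + 1) ^ m] on the
    left and [p ^ a] on the right. This is harmless if [p >= 2 ^ m], as [a + 1 <= 2 ^ a]; each
    smaller prime costs a factor [m ^ m]. *)
Lemma size_divisors_bound_primes (m n : nat) : 0 < m -> 0 < n ->
  size (divisors n) ^ m <= (m ^ m) ^ count (ltn^~ (2 ^ m)) (primes n) * n.
Proof.
move=> m0; elim/ltn_ind: n => n IH n0.
have K0 : 0 < m ^ m by rewrite expn_gt0 m0.
have [n1|n_gt1] := leqP n 1.
  have -> : n = 1 by lia.
  by rewrite /= exp1n.
pose p := pdiv n; have p_pr : prime p by apply: pdiv_prime.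
have pn : p %| n by apply: pdiv_dvd.
pose n' := n`_p^'; pose a := logn p n.
have n'0 : 0 < n' by apply: part_gt0.
have En : n = p ^ a * n' by rewrite -[LHS](partnC p n0) p_part.
have a0 : 0 < a by rewrite logn_gt0 mem_primes p_pr n0.
have n'n : n' < n.
  rewrite [X in _ < X]En ltn_Pmull // -(exp1n a) ltn_exp2r //; exact: prime_gt1.
have Epr : perm_eq (primes n) (p :: primes n').
  apply: uniq_perm; rewrite ?primes_uniq //=.
    rewrite primes_uniq andbT mem_primes negb_and p_pr n'0 /=.
    by rewrite -prime_coprime // coprime_sym; apply: (@pnat_coprime p^'); rewrite ?pnatNK ?part_pnat // ?pnat_id.
  move=> q; rewrite inE {1}En primesM // ?expn_gt0 ?prime_gt0 //.
  by rewrite primesX // primes_prime // inE.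
rewrite (seq.permP Epr) /=.
apply: leq_trans (_ : (a.+1 * size (divisors n')) ^ m <= _).
  by rewrite leq_exp2r //; apply: size_divisors_pfactor.
rewrite expnMn {1}En expnD -mulnA [X in _ <= _ * X]mulnCA mulnA.
apply: leq_mul; last exact: IH.
case: ltnP => hp.
  rewrite expn1; apply: leq_trans (succ_exp_bound a m0) _.
  by rewrite leq_mul2l leq_exp2r // prime_gt1 ?orbT.
rewrite expn0 mul1n; apply: leq_trans (_ : (2 ^ m) ^ a <= _).
  by rewrite -expnM mulnC expnM leq_exp2r //; apply: ltn_expl.
by rewrite leq_exp2r.
Qed.

Lemma size_divisors_bound (m : nat) : exists2 C, 0 < C &
  forall n, 0 < n -> size (divisors n) ^ m <= C * n.
Proof.
case: m => [|m]; first by exists 1 => // n; rewrite mul1n.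
exists ((m.+1 ^ m.+1) ^ 2 ^ m.+1); first by rewrite !expn_gt0.
move=> n n0; apply: leq_trans (size_divisors_bound_primes _ n0) _ => //.
rewrite leq_mul2r leq_pexp2l ?orbT ?expn_gt0 //.
rewrite -size_filter -[leqRHS](size_iota 0).
apply: uniq_leq_size; first by rewrite filter_uniq ?primes_uniq.
by move=> q; rewrite mem_filter mem_iota /= add0n => /andP[].
Qed.

(** * Weights on tuples *)

Lemma sum_tuple_cons (T : finType) n (F : seq T -> nat) :
  \sum_(t : n.+1.-tuple T) F t = \sum_(t : n.-tuple T) \sum_(x : T) F (x :: t).
Proof.
rewrite pair_big /= (reindex (fun p : n.-tuple T * T => cons_tuple p.2 p.1)) //=.
exists (fun t : n.+1.-tuple T => (behead_tuple t, thead t)) => [[t x] _|t _] /=.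
  by congr pair; apply/val_inj.
by rewrite [RHS]tuple_eta; apply/val_inj.
Qed.

Section Weights.

Variables (N h : nat) (g : 'I_N -> 'I_N -> nat) (lev : 'I_N -> nat).

(* [g y x] is a modulus for which the entry [y] of a tuple determines the class
   of the entry [x], and [4 ^ lev x] is the modulus that all the other entries
   together must provide. The weight of [x] after the entries [s] is
   [4 ^ h * min (modulus s x, T) / sqrt (4 ^ h * T)] with [T = 4 ^ lev x];
   the powers of 4 keep it an integer. *)
Definition modulus (s : seq 'I_N) (x : 'I_N) := \big[lcmn/1]_(y <- s) g y x.

Definition weight (s : seq 'I_N) (x : 'I_N) :=
  minn (modulus s x) (4 ^ lev x) * 2 ^ (h - lev x).

Fixpoint seq_weight (s : seq 'I_N) :=
  if s is x :: s' then weight s' x * seq_weight s' else 1.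

Hypothesis g_gt0 : forall y x, 0 < g y x.
Hypothesis lev_le : forall x, lev x <= h.

Lemma modulus_gt0 s x : 0 < modulus s x.
Proof.
rewrite /modulus; elim/big_ind : _ => // a b a0 b0.
by rewrite lcmn_gt0 a0.
Qed.

Lemma dvdn_modulus s y x : y \in s -> g y x %| modulus s x.
Proof.
rewrite /modulus; elim: s => // z s IH; rewrite inE big_cons => /orP[/eqP<-|/IH].
  exact: dvdn_lcml.
by move=> /dvdn_trans; apply; apply: dvdn_lcmr.
Qed.

(** If [a b >= T] with [a, b >= 1], then [min (a, T) * min (b, T) >= T]; the powers of 2 in the two
    weights fill this up to [4 ^ h]. *)
Lemma weight_mul_ge s u x :
  4 ^ lev x <= modulus s x * modulus u x -> 4 ^ h <= weight s x * weight u x.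
Proof.
move=> hsu; rewrite /weight mulnACA -expnD.
have -> : 4 ^ h = 4 ^ lev x * 2 ^ (h - lev x + (h - lev x)).
  have := lev_le x => hl.
  by rewrite addnn -mul2n [2 ^ (2 * _)]expnM -expnD subnKC.
rewrite leq_mul2r; apply/orP; right.
move: (modulus_gt0 s x) (modulus_gt0 u x) hsu.
move: (modulus s x) (modulus u x) (4 ^ lev x) => a b c a0 b0 hab.
by rewrite /minn; case: ifP => ha; case: ifP => hb //; nia.
Qed.

(** [catrev] moves the entries one by one onto [u], the reversed prefix. Each entry is thus weighed
    once against its prefix and once against its suffix, and [weight_mul_ge] applies to each such
    pair. *)
Lemma seq_weight_catrev_ge t u :
  (forall t1 x t2, t = t1 ++ x :: t2 ->
     4 ^ lev x <= modulus (catrev t1 u) x * modulus t2 x) ->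
  (4 ^ h) ^ size t * seq_weight u <= seq_weight (catrev t u) * seq_weight t.
Proof.
elim: t u => [|x t IH] u ht; first by rewrite /= mul1n muln1.
have hx : 4 ^ h <= weight u x * weight t x by apply: weight_mul_ge; apply: (ht [::]).
have IHx : (4 ^ h) ^ size t * seq_weight (x :: u) <=
    seq_weight (catrev t (x :: u)) * seq_weight t.
  by apply: IH => t1 y t2 Et; apply: (ht (x :: t1)); rewrite Et.
rewrite /= expnS -mulnA [leqRHS]mulnCA.
apply: leq_trans (_ : weight t x * ((4 ^ h) ^ size t * seq_weight (x :: u)) <= _).
  have -> : weight t x * ((4 ^ h) ^ size t * seq_weight (x :: u)) =
      weight u x * weight t x * ((4 ^ h) ^ size t * seq_weight u) by rewrite /=; lia.
  by rewrite leq_mul2r hx orbT.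
by rewrite leq_mul2l IHx orbT.
Qed.

Variables (b0 tau : nat) (val_g : 'I_N -> seq nat).
Hypothesis g_val : forall y x, g y x \in val_g y.
Hypothesis size_val_g : forall y, size (val_g y) <= tau.
Hypothesis g_mod : forall y x : 'I_N, x = y %[mod g y x].
Hypothesis sum_class : forall q r, 0 < q ->
  \sum_(x < N | x == r %[mod q]) minn q (4 ^ lev x) * 2 ^ (h - lev x) <= b0.

(** Each entry [y] of [s] splits the class into at most [tau] parts according to the value [v] of
    [g y x]. Within a part [x] is congruent to [y] mod [v], so the part lies in one class mod
    [lcmn q v], and the induction continues with this modulus. *)
Lemma sum_weight_class s q r : 0 < q ->
  \sum_(x < N | x == r %[mod q])
     minn (lcmn q (modulus s x)) (4 ^ lev x) * 2 ^ (h - lev x) <=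
  tau ^ size s * b0.
Proof.
elim: s q r => [|y s IH] q r q0.
  rewrite /modulus mul1n; apply: leq_trans (sum_class r q0).
  by apply: leq_sum => x _; rewrite big_nil lcmn1.
have -> : \sum_(x < N | x == r %[mod q])
     minn (lcmn q (modulus (y :: s) x)) (4 ^ lev x) * 2 ^ (h - lev x) =
  \sum_(v <- undup (val_g y)) \sum_(x < N | (x == r %[mod q]) && (g y x == v))
     minn (lcmn (lcmn q v) (modulus s x)) (4 ^ lev x) * 2 ^ (h - lev x).
  rewrite (exchange_big_dep (fun x : 'I_N => x == r %[mod q])) /=; last by move=> ? ? _ /andP[].
  apply: eq_bigr => x xr.
  rewrite -big_filter (_ : [seq v <- _ | _] = [:: g y x]).
    by rewrite big_seq1 /modulus big_cons lcmnA.
  under eq_filter => v do rewrite xr /= eq_sym.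
  by rewrite filter_pred1_uniq ?undup_uniq ?mem_undup.
apply: leq_trans (_ : \sum_(v <- undup (val_g y)) tau ^ size s * b0 <= _).
  rewrite big_seq [leqRHS]big_seq; apply: leq_sum => v _.
  (* A member [x0] of the part serves as representative of the class mod [lcmn q v]; an empty part
     contributes nothing. *)
  have [/existsP[x0 /andP[/eqP x0r /eqP x0v]]|] :=
      boolP [exists x : 'I_N, (x == r %[mod q]) && (g y x == v)]; last first.
    by rewrite negb_exists => /forallP no; rewrite big_pred0 // => x; apply/negbTE/no.
  have v0 : 0 < v by rewrite -x0v.
  apply: leq_trans (IH (lcmn q v) x0 _); last by rewrite lcmn_gt0 q0.
  rewrite [leqLHS]big_mkcond [leqRHS]big_mkcond; apply: leq_sum => x _.
  case: ifP => // /andP[/eqP xr /eqP xv]; case: ifP => // /negbT/negP[].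
  have xx0q : x = x0 %[mod q] by rewrite xr x0r.
  have xx0v : x = x0 %[mod v] by rewrite -{1}xv g_mod -x0v g_mod xv x0v.
  wlog le : x x0 xx0q xx0v {xr xv x0r x0v} / x0 <= x.
    move=> H; have [|/ltnW] := leqP x0 x; first exact: H.
    by move=> /(H _ _ (esym xx0q) (esym xx0v)); rewrite eq_sym.
  rewrite eqn_mod_dvd // dvdn_lcm -!eqn_mod_dvd //.
  by apply/andP; split; apply/eqP.
rewrite big_const_seq count_predT iter_addn_0 /= expnS mulnC -mulnA leq_mul2r.
by rewrite (leq_trans (size_undup _)) ?size_val_g ?orbT.
Qed.

Lemma sum_weight s : \sum_(x < N) weight s x <= tau ^ size s * b0.
Proof.
apply: leq_trans (@sum_weight_class s 1 0 isT).
by rewrite [leqRHS](eq_bigl predT) => [|x]; [apply: leq_sum => x _; rewrite lcm1n|rewrite !modn1].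
Qed.

Lemma sum_seq_weight n : 0 < tau ->
  \sum_(t : n.-tuple 'I_N) seq_weight t <= (tau ^ n * b0) ^ n.
Proof.
move=> tau0.
suff H m : m <= n -> \sum_(t : m.-tuple 'I_N) seq_weight t <= (tau ^ n * b0) ^ m by exact: H.
elim: m => [|m IH] mn.
  by rewrite (bigD1 [tuple]) //= big1 ?addn0 // => t; rewrite tuple0.
rewrite sum_tuple_cons expnSr; apply: leq_trans (_ :
  \sum_(t : m.-tuple 'I_N) (tau ^ n * b0) * seq_weight t <= _).
  apply: leq_sum => t _ /=; rewrite -big_distrl /= leq_mul2r.
  rewrite (leq_trans (sum_weight t)) ?orbT // size_tuple leq_mul2r.
  by rewrite leq_pexp2l ?orbT // ltnW.
by rewrite -big_distrr /= mulnC leq_mul2r IH ?orbT // ltnW.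
Qed.

(* Each admissible tuple has weight at least [2 ^ (h n)] either as it is or
   reversed, because the product of the two weights is at least [4 ^ (h n)]. *)
Lemma card_split_tuples n (X : {set n.-tuple 'I_N}) : 0 < tau ->
  (forall t : n.-tuple 'I_N, t \in X ->
     forall t1 x t2, t = t1 ++ x :: t2 :> seq _ ->
     4 ^ lev x <= modulus t1 x * modulus t2 x) ->
  #|X| * (2 ^ h) ^ n <= 2 * (tau ^ n * b0) ^ n.
Proof.
move=> tau0 hX.
have modulus_rev s x : modulus (rev s) x = modulus s x.
  by apply: perm_big; rewrite perm_rev.
have big_t t : t \in X -> (2 ^ h) ^ n <= seq_weight t + seq_weight (rev_tuple t).
  move=> tX; have : (4 ^ h) ^ n <= seq_weight (rev t) * seq_weight t.
    rewrite -[X in _ ^ X <= _](size_tuple t) -[leqLHS]muln1.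
    apply: (@seq_weight_catrev_ge t [::]) => t1 x t2 /(hX _ tX).
    by rewrite -[catrev t1 [::]]/(rev t1) modulus_rev.
  have -> : (4 ^ h) ^ n = (2 ^ h) ^ n * (2 ^ h) ^ n by rewrite -!expnMn.
  by move: (_ ^ n) (seq_weight _) (seq_weight _) => a b c /=; nia.
rewrite -sum_nat_const; apply: leq_trans (_ :
  \sum_(t : n.-tuple 'I_N) (seq_weight t + seq_weight (rev_tuple t)) <= _).
  by rewrite [leqLHS]big_mkcond; apply: leq_sum => t _; case: ifP => // /big_t.
have rev_inj : injective (@rev_tuple n 'I_N).
  by move=> t1 t2 /(congr1 val)/= /(can_inj revK) /val_inj.
have E : \sum_(t : n.-tuple 'I_N) seq_weight (rev_tuple t) =
    \sum_(t : n.-tuple 'I_N) seq_weight t by rewrite [RHS](reindex_inj rev_inj).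
by rewrite big_split /= E mul2n -addnn leq_add ?sum_seq_weight.
Qed.

End Weights.

(** * Divisors of numerators of sums of fractions *)

Local Open Scope ring_scope.

Lemma zcontents_dvd_coef (p : {poly int}) i : (zcontents p %| p`_i)%Z.
Proof.
have : (zcontents p %| zcontents p)%Z by [].
by rewrite dvdz_contents => /polyOverP /(_ i).
Qed.

(** A translation is invertible over the integers and keeps the content; scaling the variable by [L]
    multiplies the coefficient of index [i] by [L ^ i], a divisor of [L ^ deg f]. *)
Lemma zcontents_comp_scaleX (f : {poly int}) (a L : int) :
  (zcontents (f \Po (L *: 'X + a%:P)) %| L ^+ (size f).-1 * zcontents f)%Z.
Proof.
set k := zcontents (_ \Po _); pose f1 := f \Po ('X + a%:P).
have sz : size f1 = size f by rewrite size_comp_poly2 ?size_XaddC.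
have kf1 : (k %| zcontents (L ^+ (size f).-1 *: f1))%Z.
  rewrite dvdz_contents; apply/polyOverP => i; rewrite coefZ.
  have [hi|hi] := ltnP i (size f); last by rewrite nth_default ?sz // mulr0 dvdz0.
  have -> : (size f).-1 = (i + ((size f).-1 - i))%N by lia.
  rewrite exprD mulrAC dvdz_mulr //.
  suff -> : L ^+ i * f1`_i = (f \Po (L *: 'X + a%:P))`_i by apply: zcontents_dvd_coef.
  have -> : f \Po (L *: 'X + a%:P) = f1 \Po (L *: 'X).
    by rewrite -comp_polyA comp_polyD comp_polyX comp_polyC.
  rewrite comp_polyE coef_sum.
  under eq_bigr => j _ do rewrite exprZn scalerA coefZ coefXn.
  have hi1 : (i < size f1)%N by rewrite sz.
  rewrite (bigD1 (Ordinal hi1)) //= eqxx mulr1 big1 ?addr0 1?mulrC // => j.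
  rewrite -val_eqE /= => ne; rewrite eq_sym (negbTE ne) mulr0 //.
have -> : L ^+ (size f).-1 * zcontents f = zcontents (L ^+ (size f).-1 *: f).
  by rewrite zcontentsZ.
have -> : L ^+ (size f).-1 *: f =
    (L ^+ (size f).-1 *: f1) \Po ('X - a%:P).
  rewrite comp_polyZ -comp_polyA comp_polyD comp_polyX comp_polyC.
  by rewrite subrK comp_polyXr.
move: kf1; rewrite !dvdz_contents; move: (_ *: f1) => g /polyOverP kg.
apply/polyOverP => i; rewrite coef_comp_poly; apply: rpred_sum => j _.
by apply: dvdz_mulr; apply: kg.
Qed.

(* The numerator of the sum of the fractions [c y / ('X - a y)]. *)
Definition fracnum (T : finType) (a c : T -> int) (S : {set T}) : {poly int} :=
  \sum_(y in S) c y *: \prod_(w in S :\ y) ('X - (a w)%:P).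

Lemma fracnum_horner (T : finType) (a c : T -> int) (S : {set T}) x :
  x \in S -> (fracnum a c S).[a x] = c x * \prod_(w in S :\ x) (a x - a w).
Proof.
move=> xS; rewrite /fracnum horner_sum (bigD1 x) //= hornerZ horner_prod.
rewrite [X in _ + X]big1 ?addr0; last first.
  move=> y /andP[yS ne]; rewrite hornerZ horner_prod (bigD1 x) /=; last first.
    by rewrite in_setD1 eq_sym ne.
  by rewrite hornerXsubC subrr mul0r mulr0.
by congr (_ * _); apply: eq_bigr => w _; rewrite hornerXsubC.
Qed.

(** Writing [L = q w (a w - a x)], the factor of [w != x] becomes [(a w - a x) (q w X - 1)] and that
    of [x] becomes [L X]. In the term of [y != x], this [L X] supplies the missing [a y - a x] and
    kills the constant term, so only the term of [x] counts in [H.[0]]. *)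
Lemma fracnum_comp_scaleX (T : finType) (a c : T -> int) (S : {set T})
    (x : T) (L : int) : x \in S -> {in S :\ x, forall y, (a y - a x %| L)%Z} ->
  exists2 H : {poly int}, `|H.[0]| = `|c x| &
    fracnum a c S \Po (L *: 'X + (a x)%:P) =
      (\prod_(w in S :\ x) (a w - a x)) *: H.
Proof.
move=> xS aL; pose q y := (L %/ (a y - a x))%Z.
have qE y : y \in S :\ x -> L = q y * (a y - a x) by move=> yS; rewrite divzK ?aL.
exists (c x *: (\prod_(w in S :\ x) ((q w) *: 'X - 1)) +
   'X * \sum_(y in S :\ x) (c y * q y) *: \prod_(w in S :\ x :\ y) ((q w) *: 'X - 1)).
  rewrite !hornerE horner_prod.
  have qX0 w : (q w *: 'X - 1 : {poly int}).[0] = -1 by rewrite !hornerE; lia.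
  under eq_bigr => w _ do rewrite qX0.
  by rewrite prodr_const normrM normrX normrN normr1 expr1n mulr1.
rewrite /fracnum raddf_sum (bigD1 x) //= scalerDr; congr (_ + _).
  rewrite comp_polyZ rmorph_prod /= [RHS]scalerA mulrC -[RHS]scalerA; congr (_ *: _).
  rewrite -scaler_prod.
  apply: eq_bigr => w wS; rewrite comp_polyB comp_polyX comp_polyC.
  rewrite {1}(qE w wS) mulrC scalerBr -scalerA.
  by rewrite -!mul_polyC mulr1 polyCB; ring.
rewrite scalerAr scaler_sumr mulr_sumr.
have -> : \sum_(i in S | i != x) (c i *: \prod_(w in S :\ i) ('X - (a w)%:P)
      \Po (L *: 'X + (a x)%:P)) =
   \sum_(i in S :\ x) (c i *: \prod_(w in S :\ i) ('X - (a w)%:P)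
      \Po (L *: 'X + (a x)%:P)).
  by apply: eq_bigl => i; rewrite in_setD1 andbC.
apply: eq_bigr => y yS; move: (yS); rewrite in_setD1 => /andP[nyx yS'].
rewrite comp_polyZ rmorph_prod /= (bigD1 x) /=; last by rewrite in_setD1 eq_sym nyx.
rewrite comp_polyB comp_polyX comp_polyC addrK [X in _ = _ * (X *: _)](bigD1 y) //=.
rewrite (eq_big (fun w => w \in S :\ x :\ y)
  (fun w => (a w - a x) *: (q w *: 'X - 1))); last 2 first.
- by move=> i; rewrite !in_setD1; case: (i \in S); rewrite ?andbT ?andbF.
- move=> w; rewrite in_setD1 => /andP[/andP[wy wS] wx].
  have wSx : w \in S :\ x by rewrite in_setD1 wx.
  rewrite comp_polyB comp_polyX comp_polyC.
  rewrite {1}(qE w wSx) mulrC scalerBr -scalerA.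
  by rewrite -!mul_polyC mulr1 polyCB; ring.
rewrite scaler_prod {1}(qE y yS).
have -> : \prod_(i in S :\ x | i != y) (a i - a x) = \prod_(i in S :\ x :\ y) (a i - a x).
  by apply: eq_bigl => i; rewrite [RHS]in_setD1 andbC.
by rewrite -!mul_polyC !polyCM; ring.
Qed.

(* Substituting [X := L X + a x] turns the numerator into
   [prod (a w - a x)] times an integer polynomial with constant term [+- c x],
   so by multiplicativity of contents the constant term [f.[a x]] divides
   [c x] times the content of [f (L X + a x)]. *)
Lemma factor_horner_dvd (T : finType) (a c : T -> int) (S : {set T})
    (f g : {poly int}) (x : T) (L : int) :
  zcontents f = 1 -> fracnum a c S = f * g -> x \in S -> c x != 0 ->
  {in S :\ x, forall y, a y != a x} ->
  {in S :\ x, forall y, (a y - a x %| L)%Z} ->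
  (f.[a x] %| c x * L ^+ (size f).-1)%Z.
Proof.
move=> f1 Efg xS cx0 inj_a aL.
have [H H0 EH] := fracnum_comp_scaleX c xS aL.
set Y := \prod_(w in S :\ x) _ in EH.
have Y0 : Y != 0 by apply/prodf_neq0 => w wS; rewrite subr_eq0 inj_a.
have Hn0 : H != 0 by apply: contraNneq cx0 => H_; rewrite -normr_eq0 -H0 H_ horner0.
pose u := L *: 'X + (a x)%:P; pose F := f \Po u; pose G := g \Po u.
have u0 : u.[0] = a x by rewrite /u !hornerE.
have FG : F * G = Y *: H by rewrite -EH Efg comp_polyM.
have cFG : zcontents F * zcontents G = Y * zcontents H.
  by rewrite -zcontentsM FG zcontentsZ.
have F0 : F.[0] = f.[a x] by rewrite horner_comp u0.
have hFG : F.[0] * G.[0] = Y * H.[0] by rewrite -hornerM FG hornerZ.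
have [F' EF] := dvdzP (zcontents_dvd_coef F 0).
have [G' EG] := dvdzP (zcontents_dvd_coef G 0).
have [H' EH'] := dvdzP (zcontents_dvd_coef H 0).
rewrite -!horner_coef0 in EF EG EH'.
have nz : Y * zcontents H != 0 by rewrite mulf_neq0 // zcontents_eq0.
have E : F' * G' = H'.
  apply: (mulfI nz); rewrite [RHS]mulrAC -mulrA -EH' -hFG EF EG -cFG; ring.
have H0' : `|H.[0]|%N = `|c x|%N by move: H0; rewrite -!abszE => -[].
have F'c : (F' %| c x)%Z.
  have : (F' %| H.[0])%Z by rewrite EH' -E -mulrA dvdz_mulr.
  by rewrite !dvdzE H0'.
rewrite -F0 EF; apply: dvdz_mul => //.
by have := zcontents_comp_scaleX f (a x) L; rewrite f1 mulr1.
Qed.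

Lemma card_bigcup_le (T : finType) m (F : 'I_m -> {set T}) c :
  (forall i, #|F i| <= c)%N -> (#|\bigcup_i F i| <= m * c)%N.
Proof.
move=> Fc; rewrite -[X in (_ <= X * _)%N]card_ord -sum_nat_const.
apply: leq_trans (_ : \sum_(i < m) #|F i| <= _)%N; last by apply: leq_sum.
elim/big_ind2 : _ => [|a A b D hA hD|//]; first by rewrite cards0.
by rewrite (leq_trans (leq_card_setU _ _)) // leq_add.
Qed.

Lemma card_residue_class (N q B : nat) (X : {set 'I_N}) : (0 < q)%N ->
  {in X &, forall x y : 'I_N, x = y %[mod q]} ->
  {in X &, forall x y : 'I_N, (x < y + B)%N} ->
  (#|X| <= B %/ q + 1)%N.
Proof.
move=> q0 Xq XB; have [->|[x0 x0X]] := set_0Vmem X; first by rewrite cards0.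
case: (@arg_minnP _ x0 (mem X) val x0X) => m mX minm.
pose h (x : 'I_N) : 'I_(B %/ q).+1 := inord ((x - m) %/ q).
have hE x : x \in X -> h x = ((x - m) %/ q)%N :> nat.
  move=> xX; rewrite inordK // ltnS leq_div2r //.
  by have := XB x m xX mX; have := minm x xX; rewrite /=; lia.
have hinj : {in X &, injective h}.
  move=> x y xX yX /(congr1 val) /=; rewrite !hE // => E; apply: val_inj => /=.
  have d x' : x' \in X -> ((x' - m) %/ q * q = x' - m)%N.
    move=> x'X; apply/eqP; rewrite -dvdn_eq -eqn_mod_dvd; last exact: minm.
    by rewrite (Xq x' m x'X mX).
  have /= := minm x xX; have /= := minm y yX; have := d x xX; have := d y yX.
  by rewrite E; lia.
by rewrite -(card_in_imset hinj) (leq_trans (max_card _)) // card_ord addn1.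
Qed.

(** The leading coefficient is a nonzero integer, so [|f(x)|] is at least the product of the
    distances from [x] to the [d] complex roots. A value below [T ^ d] thus puts [x] within [T] of a
    root, where a class mod [q] has at most [2 T / q + 1] points. *)
Lemma card_small_values (f : {poly int}) (N d q r T : nat) :
  size f = d.+1 -> (0 < q)%N ->
  (#|[set x : 'I_N | (x == r %[mod q]) && (`|f.[x%:Z]| < (T ^ d)%N)%R]|
    <= d * (2 * T %/ q + 1))%N.
Proof.
move=> szf q0.
pose g : {poly algC} := map_poly intr f.
have szg : size g = d.+1 by rewrite size_map_inj_poly //; apply: intr_inj.
have [rs Eg] := closed_field_poly_normal g.
have lcg : 1 <= `|lead_coef g|.
  rewrite lead_coef_map_inj //; last exact: intr_inj.
  have : lead_coef f != 0 by rewrite lead_coef_eq0 -size_poly_eq0 szf.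
  by rewrite -intr_norm (ler_int _ 1) -normr_gt0; case: `|_| => // -[].
have szrs : size rs = d.
  have : lead_coef g != 0 by rewrite -normr_gt0 (lt_le_trans ltr01).
  by move=> /size_scale sc; move: szg; rewrite Eg sc size_prod_XsubC => -[].
pose X (z : algC) : {set 'I_N} :=
  [set x : 'I_N | (x == r %[mod q]) && (`|(x : nat)%:R - z| < T%:R)].
have cX z : (#|X z| <= 2 * T %/ q + 1)%N.
  apply: card_residue_class => // x y; rewrite !inE => /andP[/eqP xr xz] /andP[/eqP yr yz].
    by rewrite xr yr.
  have T0 : (0 < T)%N by rewrite -(ltr_nat algC); apply: le_lt_trans xz; apply: normr_ge0.
  have [|xy] := leqP x y; first by lia.
  have : `|(x : nat)%:R - (y : nat)%:R : algC| < T%:R + T%:R.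
    rewrite (_ : _ - _ = (x%:R - z) - (y%:R - z)); last by ring.
    by rewrite (le_lt_trans (ler_normB _ _)) // ltrD.
  rewrite -(natrB _ (ltnW xy)) normr_nat -natrD ltr_nat; lia.
apply: leq_trans (card_bigcup_le (F := fun i : 'I_d => X (nth 0%R rs i)) _);
  last by move=> i; exact: cX.
apply: subset_leq_card; apply/subsetP => x; rewrite inE => /andP[xr fx].
suff /hasP[z zrs hz] : has (fun z => `|(x : nat)%:R - z| < T%:R) rs.
  apply/bigcupP; have iz : (index z rs < d)%N by rewrite -szrs index_mem.
  by exists (Ordinal iz) => //; rewrite inE xr /= nth_index.
apply: contraLR fx; rewrite -all_predC -leNgt => /allP small.
rewrite -(ler_int algC) intr_norm.
have -> : (f.[x%:Z])%:~R = g.[(x : nat)%:R] :> algC.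
  by rewrite -(horner_map (intr : int -> algC)).
rewrite Eg hornerZ horner_prod normrM normr_prod.
apply: le_trans (_ : \prod_(z <- rs) T%:R <= _).
  by rewrite big_const_seq count_predT szrs -pmulrn natrX -Monoid.iteropE.
apply: le_trans (_ : \prod_(z <- rs) `|('X - z%:P).[(x : nat)%:R]| <= _); last first.
  by rewrite ler_peMl // prodr_ge0.
rewrite [X in X <= _]big_seq [X in _ <= X]big_seq; apply: ler_prod => z zrs.
rewrite ler0n /= hornerXsubC.
have /= := small z zrs.
by rewrite real_ltNge ?realn // negbK.
Qed.

(** * Counting tuples attached to a polynomial *)

Local Open Scope nat_scope.

Lemma gcdn_biglcm (I : Type) (r : seq I) (P : pred I) (F : I -> nat) a :
  gcdn a (\big[lcmn/1]_(i <- r | P i) F i) = \big[lcmn/1]_(i <- r | P i) gcdn a (F i).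
Proof.
elim/big_rec2 : _ => [|i u v _ <-]; first exact: gcdn1.
by rewrite gcdnC Order.NatDvd.meetUl ![gcdn _ a]gcdnC.
Qed.

(** Write [a = a' m] and [b = b' m] with [m] the gcd: [a'] is coprime to [b'], so after cancelling
    one [m] it divides [m ^ (d - 1)]. *)
Lemma dvdn_gcd_exp a b d : 0 < d -> a %| b ^ d -> a %| gcdn a b ^ d.
Proof.
case: d => // d _ ab; have [a0|a_gt0] := posnP a.
  by move: ab; rewrite a0 gcd0n.
set m := gcdn a b; have m0 : 0 < m by rewrite gcdn_gt0 a_gt0.
have [a' Ea] := dvdnP (dvdn_gcdl a b); have [b' Eb] := dvdnP (dvdn_gcdr a b).
rewrite -/m in Ea Eb.
have cop : coprime a' (b' ^ d.+1).
  apply: coprimeXr; rewrite /coprime -(eqn_pmul2r m0) muln_gcdl -Ea -Eb.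
  by rewrite mul1n.
move: ab; rewrite {1}Ea {1}Eb expnMn (expnSr m) mulnA dvdn_pmul2r //.
by rewrite Gauss_dvdr // => ha; rewrite {1}Ea dvdn_mul.
Qed.

Lemma horner_sub_dvd (f : {poly int}) (x y : int) :
  (x - y %| f.[x] - f.[y])%Z%R.
Proof.
have /factor_theorem[q Eq] : root (f - f.[y]%:P)%R y.
  by rewrite /root !hornerE GRing.subrr.
have -> : (f.[x] - f.[y] = q.[x] * (x - y))%R.
  by have := congr1 (horner^~ x) Eq; rewrite !hornerE.
exact: dvdz_mull.
Qed.

Section PolyWeights.

Variables (f : {poly int}) (d N h B : nat).

Definition absval (x : 'I_N) := `|f.[(x : nat)%:Z]%R|.

(* Bad points can only occur in a tuple as repeated entries; for these the value
   [4 ^ h >= N] of [link] on the diagonal makes [x] determined by [y]. *)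
Definition good (x : 'I_N) := 0 < absval x <= B.

(** For good [x], [4 ^ level x] is the [d]-th root of [|f(x)|] rounded down to a power of 4 and
    capped at [4 ^ h]. *)
Definition level x := if good x then minn h (trunc_log (4 ^ d) (absval x)) else h.

Definition link (y x : 'I_N) :=
  if y == x then 4 ^ h
  else if good y then gcdn (absval y) (absz (Posz y - Posz x)%R) else 1.

Definition links (y : 'I_N) :=
  4 ^ h :: (if good y then divisors (absval y) else [:: 1]).

Hypothesis d_gt0 : 0 < d.
Hypothesis size_f : size f = d.+1.
Hypothesis N_le : N <= 4 ^ h.

Lemma level_le x : level x <= h.
Proof. by rewrite /level; case: ifP => // _; apply: geq_minl. Qed.

Lemma four_exp_d : 1 < 4 ^ d.
Proof. by rewrite -(exp1n d) ltn_exp2r. Qed.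

Lemma level_good x : good x -> (4 ^ level x) ^ d <= absval x.
Proof.
move=> gx; rewrite /level gx -expnM mulnC expnM.
apply: leq_trans (trunc_logP four_exp_d _); last by case/andP: gx.
by rewrite leq_exp2l ?geq_minr ?four_exp_d.
Qed.

Lemma level_lt x : level x < h -> absval x < (4 ^ (level x).+1) ^ d.
Proof.
rewrite /level; case: ifP => _; last by rewrite ltnn.
rewrite -expnM mulnC expnM.
by rewrite /minn; case: ifP => [|_ _]; [rewrite ltnn|apply: trunc_log_ltn four_exp_d].
Qed.

Lemma link_gt0 y x : 0 < link y x.
Proof.
rewrite /link; case: eqP => _; first by rewrite expn_gt0.
by case: ifP => // /andP[y0 _]; rewrite gcdn_gt0 y0.
Qed.

Lemma link_links y x : link y x \in links y.
Proof.
rewrite /link /links inE; have [_|_] := eqVneq y x; first by rewrite eqxx.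
case: ifP => [/andP[y0 _]|_]; last by rewrite inE eqxx orbT.
by rewrite -dvdn_divisors // dvdn_gcdl orbT.
Qed.

Lemma link_mod (y x : 'I_N) : x = y %[mod link y x].
Proof.
rewrite /link; case: eqP => [->//|_]; case: ifP => _; last by rewrite !modn1.
have : gcdn (absval y) (absz (Posz y - Posz x)%R) %| (absz (Posz y - Posz x)%R)
  by apply: dvdn_gcdr.
move: (gcdn _ _) => m; wlog le : x y / x <= y.
  move=> H; case: (leqP x y) => [|/ltnW] le; first exact: H.
  by rewrite -abszN GRing.opprB => /(H _ _ le).
rewrite distnEl // => md; apply/eqP; rewrite eq_sym eqn_mod_dvd //.
Qed.

(** By [card_small_values], a class has at most [d (8 * 4 ^ s / q + 1)] points of level [s < h]; for
    [s = h] the bound [N <= 4 ^ h] suffices. Multiplied by [min (q, 4 ^ s)] this is at most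
    [9 d 4 ^ s], and the sum over [s] of [4 ^ s * 2 ^ (h - s) = 2 ^ h * 2 ^ s] is geometric. *)
Lemma sum_class_level q r : 0 < q ->
  \sum_(x < N | x == r %[mod q]) minn q (4 ^ level x) * 2 ^ (h - level x) <=
  18 * d * 4 ^ h.
Proof.
move=> q0.
rewrite (partition_big (fun x => inord (level x) : 'I_h.+1) predT) //=.
have level_inord x (s : 'I_h.+1) : (inord (level x) == s) = (level x == s).
  by rewrite -val_eqE /= inordK // ltnS level_le.
apply: leq_trans (_ : \sum_(s < h.+1) 9 * d * 4 ^ s * 2 ^ (h - s) <= _).
  apply: leq_sum => s _.
  pose X := [set x : 'I_N | (x == r %[mod q]) && (level x == s)].
  have cX : #|X| <= d * (2 * 4 ^ s.+1 %/ q + 1).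
    have [sh|hs] := ltnP s h.
      apply: leq_trans (card_small_values N r _ size_f q0).
      apply: subset_leq_card; apply/subsetP => x; rewrite !inE => /andP[-> /eqP xs] /=.
      have := @level_lt x; rewrite xs => /(_ sh); rewrite /absval.
      by rewrite -(ltr_nat int) !natz abszE.
    apply: leq_trans (card_residue_class (B := N) q0 _ _) _.
    - by move=> x y; rewrite !inE => /andP[/eqP-> _] /andP[/eqP-> _].
    - by move=> x y _ _; have := ltn_ord x; lia.
    apply: leq_trans (_ : 2 * 4 ^ s.+1 %/ q + 1 <= _); last by rewrite leq_pmull.
    rewrite leq_add2r leq_div2r // (leq_trans N_le) //.
    have sh : h = s by apply/eqP; rewrite eqn_leq hs -ltnS ltn_ord.
    by rewrite {1}sh expnS; lia.
  rewrite (eq_bigr (fun=> minn q (4 ^ s) * 2 ^ (h - s))); last first.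
    by move=> x /andP[_]; rewrite level_inord => /eqP->.
  rewrite (eq_bigl (fun x => x \in X)); last by move=> x; rewrite inE level_inord.
  rewrite sum_nat_const mulnA leq_mul2r; apply/orP; right.
  apply: leq_trans (leq_mul cX (leqnn _)) _.
  have := leq_divM (2 * 4 ^ s.+1) q; rewrite expnS.
  have := geq_minl q (4 ^ s); have := geq_minr q (4 ^ s).
  set m := minn _ _; set a := 4 ^ s; set b := _ %/ q => *; nia.
apply: leq_trans (_ : \sum_(s < h.+1) 9 * d * 2 ^ h * 2 ^ s <= _).
  apply: leq_sum => s _.
  have -> : 2 ^ h = 2 ^ s * 2 ^ (h - s) by rewrite -expnD subnKC // -ltnS.
  by rewrite (expnMn 2 2) //; lia.
rewrite -big_distrr /=.
have -> : \sum_(i < h.+1) 2 ^ i = 2 ^ h.+1 - 1.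
  by rewrite subn1 (predn_exp 2) mul1n.
have -> : 4 ^ h = 2 ^ h * 2 ^ h by rewrite -expnMn.
by rewrite expnS; move: (2 ^ h) => a; nia.
Qed.

(* [T] collects the points whose differences with [x] control [f.[x]]; only
   good points are allowed there, so that [link y x] is the true gcd. *)
Lemma card_poly_tuples n tau (X : {set n.-tuple 'I_N}) : 1 < tau ->
  (forall m, 0 < m <= B -> size (divisors m) < tau) ->
  (forall t : n.-tuple 'I_N, t \in X ->
     forall t1 x t2, t = t1 ++ x :: t2 :> seq _ -> x \notin t1 ++ t2 ->
     good x /\ exists T : {set 'I_N},
       {in T, forall y, [&& y \in t1 ++ t2, y != x & good y]} /\
       absval x %| (\big[lcmn/1]_(y in T) (absz (Posz y - Posz x)%R)) ^ d) ->
  #|X| <= 2 * (tau ^ n * (18 * d)) ^ n * (2 ^ h) ^ n.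
Proof.
move=> tau1 htau hX.
have E : 4 ^ h = 2 ^ h * 2 ^ h by rewrite -expnMn.
suff : #|X| * (2 ^ h) ^ n <= 2 * (tau ^ n * (18 * d * 4 ^ h)) ^ n.
  have -> : tau ^ n * (18 * d * 4 ^ h) = tau ^ n * (18 * d) * 2 ^ h * 2 ^ h.
    by rewrite E !mulnA.
  by rewrite !expnMn !mulnA leq_pmul2r // !expn_gt0.
have size_links y : size (links y) <= tau.
  by rewrite /links /=; case: ifP => // yg; exact: htau.
apply: (card_split_tuples link_gt0 level_le link_links size_links link_mod
  sum_class_level (ltnW tau1)).
move=> t tX t1 x t2 Et.
pose lam := lcmn (modulus link t1 x) (modulus link t2 x).
have link_lam y : y \in t1 ++ t2 -> link y x %| lam.
  rewrite mem_cat => /orP[] /(dvdn_modulus link x) /dvdn_trans; apply.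
    exact: dvdn_lcml.
  exact: dvdn_lcmr.
have lam0 : 0 < lam by rewrite lcmn_gt0 !modulus_gt0 //; exact: link_gt0.
have lamP : lam <= modulus link t1 x * modulus link t2 x.
  by rewrite -muln_lcm_gcd leq_pmulr // gcdn_gt0 modulus_gt0 //; exact: link_gt0.
apply: leq_trans lamP.
(* For a repeated entry the diagonal value [4 ^ h] of [link] is already large enough. *)
have [xin|xnin] := boolP (x \in t1 ++ t2).
  have := link_lam _ xin; rewrite /link eqxx => /(dvdn_leq lam0); apply: leq_trans.
  by rewrite leq_exp2l ?level_le.
have [gx [T [hT]]] := hX t tX _ _ _ Et xnin.
(* The lcm of the differences may be replaced by its gcd with [f(x)], which is the lcm of the
   separate gcds. *)
move=> /(dvdn_gcd_exp d_gt0); rewrite gcdn_biglcm => hdvd.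
have dlam : \big[lcmn/1]_(y in T) gcdn (absval x) (absz (Posz y - Posz x)%R) %| lam.
  apply/dvdn_biglcmP => y /hT /and3P[yt nyx gy].
  apply: dvdn_trans (link_lam y yt); rewrite /link (negbTE nyx) gy dvdn_gcd dvdn_gcdr andbT.
  (* As [y - x] divides [f(y) - f(x)], a common divisor of [f(x)] and [y - x] also divides [f(y)],
     hence [link y x]. *)
  have [q Eq] := dvdzP (horner_sub_dvd f (Posz y) (Posz x)).
  rewrite -[gcdn _ _]/(absz (gcdz f.[Posz x]%R (Posz y - Posz x)%R)) -dvdzE.
  rewrite -[f.[Posz y]%R](GRing.subrK f.[Posz x]%R) Eq.
  by rewrite GRing.rpredD ?dvdz_gcdl // dvdz_mull // dvdz_gcdr.
have le_lam : absval x <= lam ^ d.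
  apply: dvdn_leq; first by rewrite expn_gt0 lam0.
  exact: dvdn_trans hdvd (dvdn_exp2r _ dlam).
by rewrite -(leq_exp2r _ _ d_gt0) (leq_trans (level_good gx)).
Qed.

End PolyWeights.

Local Open Scope ring_scope.

Section TupleNumerator.

Variables (k N : nat).
Implicit Types (t : seq 'I_N) (x y : 'I_N).

Definition point x : int := (x : nat)%:Z.

(* The multiplicity of [x] on the left-hand side of the equation, [t] listing
   the variables of both sides, minus its multiplicity on the right. *)
Definition mult t x : int :=
  (count_mem x (take k t))%:Z - (count_mem x (drop k t))%:Z.

Definition tsupp t : {set 'I_N} := [set x | mult t x != 0].

Definition tnum t : {poly int} := fracnum point (mult t) (tsupp t).

Lemma tsupp_mem t x : x \in tsupp t -> x \in t.
Proof.
rewrite inE; apply: contraR => xt.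
rewrite /mult !(count_memPn _) ?subrr //; apply: contra xt; first exact: mem_drop.
exact: mem_take.
Qed.

Lemma card_tsupp t : (#|tsupp t| <= size t)%N.
Proof.
apply: leq_trans (card_size t); apply: subset_leq_card; apply/subsetP => x.
exact: tsupp_mem.
Qed.

Lemma mult_le t x : (`|mult t x| <= size t)%N.
Proof.
have := cat_take_drop k t; move/(congr1 (count_mem x)); rewrite count_cat.
have : (count_mem x t <= size t)%N by apply: count_size.
by rewrite /mult; lia.
Qed.

(** An unrepeated entry cannot cancel: it lies in the support, and the factor [c x] in
    [factor_horner_dvd] is a unit there. *)
Lemma mult_unique t1 x t2 : x \notin t1 ++ t2 -> `|mult (t1 ++ x :: t2) x|%N = 1%N.
Proof.
move=> xn; set t := t1 ++ x :: t2.
have h0 : (count_mem x t1 + count_mem x t2 = 0)%N by rewrite -count_cat; apply/count_memPn.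
have h1 : (count_mem x (take k t) + count_mem x (drop k t) = 1)%N.
  by rewrite -count_cat cat_take_drop count_cat /= eqxx addnCA h0.
by rewrite /mult; lia.
Qed.

Lemma point_inj : injective point.
Proof. by move=> x y [] /val_inj. Qed.

Lemma tnum_horner_neq0 t x : x \in tsupp t -> (tnum t).[point x] != 0.
Proof.
move=> xS; rewrite fracnum_horner // mulf_neq0 //; first by move: xS; rewrite inE.
apply/prodf_neq0 => w; rewrite in_setD1 => /andP[nwx _].
by rewrite subr_eq0; apply: contraNneq nwx => /point_inj ->.
Qed.

Lemma tnum_horner_le t x : x \in tsupp t ->
  (`|(tnum t).[point x]| <= size t * N ^ size t)%N.
Proof.
move=> xS; rewrite fracnum_horner // abszM leq_mul //.
  exact: mult_le.
have N0 : (0 < N)%N by apply: leq_trans (ltn_ord x).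
have -> : absz (\prod_(w in tsupp t :\ x) (point x - point w)) =
    (\prod_(w in tsupp t :\ x) absz (point x - point w)%R)%N.
  by apply: (big_morph absz abszM).
apply: leq_trans (_ : \prod_(w in tsupp t :\ x) N <= _)%N.
  apply: leq_prod => w _; rewrite /point; have := ltn_ord x; have := ltn_ord w; lia.
rewrite prod_nat_const leq_pexp2l // (leq_trans _ (card_tsupp t)) //.
by apply/subset_leq_card/subsetDl.
Qed.

Lemma card_tuples_dvd_tnum (f : {poly int}) (d h tau n : nat)
    (X : {set n.-tuple 'I_N}) :
  zcontents f = 1 -> size f = d.+1 -> (0 < d)%N -> (N <= 4 ^ h)%N -> (1 < tau)%N ->
  (forall m, 0 < m <= n * N ^ n -> size (divisors m) < tau)%N ->
  (forall t : n.-tuple 'I_N, t \in X -> exists g, tnum t = f * g) ->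
  (#|X| <= 2 * (tau ^ n * (18 * d)) ^ n * (2 ^ h) ^ n)%N.
Proof.
move=> f1 szf d0 Nh tau1 htau hX.
apply: (card_poly_tuples d0 szf Nh tau1 htau) => t tX t1 x t2 Et xnin.
have [g Eg] := hX t tX.
(* At a point of the support [f(y)] divides the nonzero value of the numerator, so it is nonzero and
   no larger than that value. *)
have goodS y : y \in tsupp t -> good f (n * N ^ n) y.
  move=> yS; have := tnum_horner_le yS; have := tnum_horner_neq0 yS.
  rewrite Eg hornerM size_tuple /good /absval /point abszM => fg0 fgle.
  have : (0 < `|f.[Posz y]| * `|g.[Posz y]|)%N by rewrite -abszM absz_gt0.
  rewrite muln_gt0 => /andP[-> g0] /=; apply: leq_trans fgle; rewrite leq_pmulr //.
have m1 : `|mult t x|%N = 1%N by rewrite Et mult_unique.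
have xS : x \in tsupp t by rewrite inE -absz_eq0 m1.
split; first exact: goodS.
exists (tsupp t :\ x); split.
  move=> y; rewrite in_setD1 => /andP[nyx yS]; rewrite nyx goodS // !andbT.
  by have := tsupp_mem yS; rewrite Et !mem_cat inE (negbTE nyx).
pose L := \big[lcmn/1%N]_(y in tsupp t :\ x) `|Posz y - Posz x|%N.
have := factor_horner_dvd (L := Posz L) f1 Eg xS.
rewrite -absz_eq0 m1 => /(_ isT) H.
have := H _ _; rewrite szf /= dvdzE abszM m1 mul1n abszX; apply.
  by move=> y; rewrite in_setD1 => /andP[nyx _]; rewrite (inj_eq point_inj).
by move=> y yS; rewrite dvdzE; apply: (biglcmn_sup y).
Qed.

End TupleNumerator.

(** * Lifting from F_p to the algebraic numbers *)

Lemma norm_resultant_le (p q : {poly int}) (B : int) :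
  (forall i, `|p`_i| <= B) -> (forall i, `|q`_i| <= B) ->
  `|resultant p q| <= ((size q).-1 + (size p).-1)`!%:Z * B ^+ ((size q).-1 + (size p).-1).
Proof.
set m := ((size q).-1 + _)%N => pB qB; have B0 : 0 <= B by apply: le_trans (pB 0).
rewrite /resultant /determinant.
apply: le_trans (ler_norm_sum _ _ _) _.
apply: le_trans (_ : \sum_(s : 'S_m) B ^+ m <= _); last first.
  by rewrite sumr_const card_Sn -mulr_natl natz.
apply: ler_sum => s _; rewrite normrM normrX normrN normr1 expr1n mul1r normr_prod.
apply: le_trans (_ : \prod_(i < m) B <= _); last by rewrite prodr_const card_ord.
apply: ler_prod => i _; rewrite normr_ge0 /= Sylvester_mxE.
by case: split => j; case: leq; rewrite ?mulr1n ?mulr0n ?normr0.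
Qed.

Lemma intr_Fp_eq0 (p : nat) (z : int) : prime p ->
  (z%:~R == 0 :> 'F_p) = (p %| `|z|)%N.
Proof.
move=> p_pr; rewrite (dvdn_pcharf (pchar_Fp p_pr)).
by case: z => n //; rewrite NegzE intrN oppr_eq0 /= .
Qed.

(** The resultant is a combination of [f] and [g], so it vanishes mod [p] at the common root [u];
    being smaller than [p], it is zero. Hence the gcd is not constant and has a complex root. The
    condition [B < p] excludes constant [f] and [g]. *)
Lemma common_root_algC (p : nat) (f g : {poly int}) (B n : nat) (u : 'F_p) :
  prime p -> f != 0 -> g != 0 -> (size f <= n.+1)%N -> (size g <= n.+1)%N ->
  (forall i, `|f`_i| <= B%:Z) -> (forall i, `|g`_i| <= B%:Z) ->
  ((2 * n)`! * B ^ (2 * n) < p)%N -> (B < p)%N ->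
  root (map_poly intr f) u -> root (map_poly intr g) u ->
  exists2 z : algC, root (map_poly intr f) z & root (map_poly intr g) z.
Proof.
move=> p_pr f0 g0 szf szg fB gB resp Bp fu gu.
have B0 : (0 < B)%N.
  move: f0; rewrite -lead_coef_eq0 -normr_gt0 => l0.
  by have := lt_le_trans l0 (fB _).
have nonconst (h : {poly int}) : h != 0 -> (forall i, `|h`_i| <= B%:Z) ->
    root (map_poly intr h) u -> (1 < size h)%N.
  move=> h0 hB hu; rewrite ltnNge; apply/negP => /size1_polyC Eh.
  move: hu h0 (hB 0%N); rewrite Eh map_polyC /root hornerC polyC_eq0 /= intr_Fp_eq0 // coefC eqxx.
  move=> /dvdn_leq H c0; rewrite absz_gt0 in H; have := H c0; lia.
have sf := nonconst f f0 fB fu; have sg := nonconst g g0 gB gu.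
have res0 : resultant f g = 0.
  have [[v w] _ /= E] := resultant_in_ideal sf sg.
  have : (resultant f g)%:~R == 0 :> 'F_p.
    have := congr1 (fun r : {poly int} => (map_poly intr r).[u]) E.
    rewrite map_polyC hornerC /= => ->.
    by rewrite rmorphD !rmorphM /= hornerD !hornerM (rootP fu) (rootP gu) !mulr0 addr0.
  rewrite intr_Fp_eq0 // => /dvdn_leq H; apply/eqP; rewrite -absz_eq0 -leqn0 leqNgt.
  apply/negP => /H; rewrite leqNgt => /negP[]; apply: leq_ltn_trans resp.
  have := norm_resultant_le fB gB; set m := (_ + _)%N => /= hm.
  have mn : (m <= 2 * n)%N by rewrite /m; lia.
  have : (`|resultant f g| <= m`! * B ^ m)%N.
    by rewrite -lez_nat abszE PoszM; rewrite -[((B ^ m)%N : int)]natz natrX natz.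
  move=> /leq_trans; apply; rewrite leq_mul ?leq_pexp2l //.
  by apply: dvdn_leq; rewrite ?fact_gt0 // -(bin_fact mn) mulnCA dvdn_mulr.
have : (1 < size (gcdp f g))%N by rewrite -resultant_eq0 res0.
set d := gcdp f g => sd.
have [z zd] : exists z : algC, root (map_poly intr d) z.
  apply/closed_rootP; rewrite size_map_inj_poly //; last exact: intr_inj.
  by rewrite neq_ltn sd orbT.
have root_dvd (h : {poly int}) : d %| h -> root (map_poly intr h) z.
  move=> /Pdiv.Idomain.dvdpP [[c q] /= c0 E].
  have := congr1 (fun r : {poly int} => (map_poly intr r).[z]) E.
  rewrite map_polyZ rmorphM /= hornerZ hornerM (rootP zd) mulr0 => /eqP.
  by rewrite mulf_eq0 intr_eq0 (negbTE c0).
by exists z; apply: root_dvd; [exact: dvdp_gcdl|exact: dvdp_gcdr].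
Qed.

(* Gauss: a multiple over [rat] of a primitive integer polynomial is a multiple
   over [int]. *)
Lemma primitive_min_poly (z : algC) :
  exists f : {poly int}, [/\ zcontents f = 1, (1 < size f)%N &
    forall Q : {poly int}, root (map_poly intr Q) z -> exists g, Q = f * g].
Proof.
have [p [Ep p_monic] pP] := minCpolyP z.
have [q [a a0 Epq]] := rat_poly_scale p.
have a0' : a%:~R != 0 :> rat by rewrite intr_eq0.
have p0 : p != 0 by apply: monic_neq0.
have q0 : q != 0 by apply: contraNneq p0 => q0; rewrite Epq q0 rmorph0 scaler0.
pose f := zprimitive q.
have zf : zcontents f = 1 by rewrite zcontents_primitive q0.
pose b : rat := a%:~R^-1 * (zcontents q)%:~R.
have b0 : b != 0 by rewrite mulf_neq0 ?invr_eq0 // intr_eq0 zcontents_eq0.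
have Epf : p = b *: map_poly intr f.
  by rewrite Epq {1}[q]zpolyEprim map_polyZ scalerA.
exists f; split => //.
  have := size_minCpoly z; rewrite Ep size_map_poly Epf size_scale // size_map_inj_poly //.
  exact: intr_inj.
move=> Q; have -> : map_poly intr Q = map_poly (ratr : rat -> algC) (map_poly intr Q).
  by rewrite -map_poly_comp; apply: eq_map_poly => x /=; rewrite ratr_int.
rewrite pP Epf dvdpZl // => /dvdpP[h Eh].
have [h' [e e0 Eh']] := rat_poly_scale h.
have e0' : e%:~R != 0 :> rat by rewrite intr_eq0.
have E : e *: Q = h' * f.
  apply: (map_inj_poly (f := intr : int -> rat)) => //; first exact: intr_inj.
  by rewrite map_polyZ rmorphM Eh Eh' /= -scalerAl scalerA mulfV // scale1r.
have ce : e * zcontents Q = zcontents h'.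
  by rewrite -zcontentsZ E zcontentsM zf mulr1.
exists (zcontents Q *: zprimitive h'); apply: (@mulfI _ e%:P); first by rewrite polyC_eq0.
rewrite !mul_polyC E.
by rewrite {1}[h']zpolyEprim -ce -!mul_polyC polyCM; ring.
Qed.

Lemma sum_seq_count (T : finType) (V : zmodType) (s : seq T) (F : T -> V) :
  \sum_(x <- s) F x = \sum_x F x *+ count_mem x s.
Proof.
elim: s => [|y s IH]; first by rewrite big_nil big1.
rewrite big_cons IH (bigD1 y) //= [RHS](bigD1 y) //= eqxx mulrS -addrA; congr (_ + (_ + _)).
by apply: eq_bigr => x nxy; rewrite eq_sym (negbTE nxy).
Qed.

Lemma coef_prod_XsubC_le (T : finType) (A : {set T}) (a : T -> int) (c : int) i :
  (forall x, `|a x| + 1 <= c) ->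
  `|(\prod_(x in A) ('X - (a x)%:P))`_i| <= c ^+ #|A|.
Proof.
move=> ac; rewrite -prodr_const; move: i.
elim/big_rec2 : _ => [|x b p _ IH] i; first by rewrite coef1; case: eqP.
rewrite mulrBl coefB coefXM mul_polyC coefZ.
have b0 : 0 <= b by apply: le_trans (IH 0%N).
apply: le_trans (ler_normB _ _) _; rewrite normrM.
apply: le_trans (_ : b + `|a x| * b <= _).
  by apply: lerD; [case: ifP => // _; rewrite normr0|rewrite ler_wpM2l].
by rewrite -[X in X + _]mul1r -mulrDl ler_wpM2r // addrC.
Qed.

Section TupleNumeratorBounds.

Variables (k N : nat).
Implicit Type t : seq 'I_N.

Lemma coef_tnum_le t i : (0 < N)%N ->
  `|(tnum k t)`_i| <= (size t * (size t * N ^ size t))%N%:Z.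
Proof.
move=> N0; rewrite /tnum /fracnum coef_sum.
apply: le_trans (ler_norm_sum _ _ _) _.
apply: le_trans (_ : \sum_(y in tsupp k t) (size t * N ^ size t)%N%:Z <= _); last first.
  rewrite sumr_const -mulr_natl natz -PoszM lez_nat leq_mul2r card_tsupp orbT //.
apply: ler_sum => y yS; rewrite coefZ normrM PoszM; apply: ler_pM => //.
  by rewrite -abszE lez_nat mult_le.
apply: le_trans (@coef_prod_XsubC_le _ _ _ N%:Z _ _) _.
  by move=> x; rewrite /point ger0_norm //; have := ltn_ord x; lia.
rewrite -[N%:Z]natz -natrX natz lez_nat leq_pexp2l //.
by apply: leq_trans (card_tsupp k t); apply/subset_leq_card/subsetDl.
Qed.

Lemma size_tnum_le t : (size (tnum k t) <= (size t).+1)%N.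
Proof.
apply: (leq_trans (size_sum _ _ _)); apply/bigmax_leqP => y yS.
apply: (leq_trans (size_scale_leq _ _)).
rewrite -big_enum size_prod_XsubC -cardE ltnS.
by apply: leq_trans (card_tsupp k t); apply/subset_leq_card/subsetDl.
Qed.

(** At [u] the numerator is the product of all [u - x] over the support times the difference of the
    two sides; entries outside the support occur equally often on both sides. *)
Lemma root_tnum (F : fieldType) (u : F) t :
  (forall x : 'I_N, u - (x : nat)%:R != 0) ->
  \sum_(x <- take k t) (u - (x : nat)%:R)^-1 = \sum_(x <- drop k t) (u - (x : nat)%:R)^-1 ->
  root (map_poly intr (tnum k t)) u.
Proof.
move=> u0 /eqP; rewrite -subr_eq0 [X in X - _]sum_seq_count [X in _ - X]sum_seq_count -sumrB => /eqP sum0.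
apply/rootP; rewrite /tnum /fracnum raddf_sum horner_sum /=.
pose w (x : 'I_N) := u - (x : nat)%:R.
have -> : \sum_(y in tsupp k t) (map_poly intr
    (mult k t y *: \prod_(x in tsupp k t :\ y) ('X - (point x)%:P))).[u] =
  \sum_(y in tsupp k t) (\prod_(x in tsupp k t) w x) *
    ((w y)^-1 *+ count_mem y (take k t) - (w y)^-1 *+ count_mem y (drop k t)).
  apply: eq_bigr => y yS; rewrite map_polyZ hornerZ rmorph_prod horner_prod /=.
  under eq_bigr => x _ do rewrite map_polyXsubC hornerXsubC.
  rewrite [in RHS](big_setD1 y) //= /mult intrB -!pmulrn -!(mulr_natr (w y)^-1) -mulrBr.
  by rewrite mulrACA [in RHS]mulrA mulfV ?u0 // mul1r mulrC.
rewrite -mulr_sumr.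
have -> : \sum_(y in tsupp k t)
    ((w y)^-1 *+ count_mem y (take k t) - (w y)^-1 *+ count_mem y (drop k t)) = 0;
  last by rewrite mulr0.
rewrite -[RHS]sum0 [RHS](bigID (mem (tsupp k t))) /= [X in _ = _ + X]big1 ?addr0 // => y.
by rewrite inE negbK subr_eq0 => /eqP[->]; rewrite subrr.
Qed.

End TupleNumeratorBounds.

Lemma card_root_tuples (p k n N h tau : nat) (u : 'F_p)
    (X : {set n.-tuple 'I_N}) :
  prime p -> (0 < n)%N -> (0 < N <= 4 ^ h)%N -> (1 < tau)%N ->
  (forall m, 0 < m <= n * N ^ n -> size (divisors m) < tau)%N ->
  ((2 * n)`! * (n * (n * N ^ n)) ^ (2 * n) < p)%N ->
  (forall t : n.-tuple 'I_N, t \in X -> root (map_poly intr (tnum k t)) u) ->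
  (#|X| <= n * (2 * (tau ^ n * (18 * n)) ^ n * (2 ^ h) ^ n))%N.
Proof.
move=> p_pr n0 /andP[N0 Nh] tau1 htau resp hX.
set c := (2 * _ * _)%N.
have key (f : {poly int}) (Y : {set n.-tuple 'I_N}) :
    zcontents f = 1 -> (1 < size f <= n.+1)%N ->
    (forall t : n.-tuple 'I_N, t \in Y -> exists g, tnum k t = f * g) ->
    (#|Y| <= c)%N.
  move=> f1 /andP[sf fn] hY.
  have d0 : (0 < (size f).-1)%N by lia.
  have szf : size f = (size f).-1.+1 by lia.
  apply: leq_trans (card_tuples_dvd_tnum f1 szf d0 Nh tau1 htau hY) _.
  rewrite leq_mul2r leq_mul2l leq_exp2r // !leq_mul2l.
  by rewrite (_ : (size f).-1 <= n)%N ?orbT //; lia.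
have [t0 /andP[t0X nz0]|none] := pickP [pred t : n.-tuple 'I_N | (t \in X) && (tnum k t != 0)]; last first.
  (* If all numerators vanish, any primitive polynomial of degree between 1 and [n] divides them;
     take ['X]. *)
  apply: leq_trans (_ : c <= _)%N; last by rewrite leq_pmull.
  apply: (key 'X); first by rewrite zcontents_monic ?monicX.
    by rewrite size_polyX ltnS.
  move=> t tX; exists 0; rewrite mulr0; apply/eqP.
  by have := none t; rewrite /= tX => /negbT; rewrite negbK.
pose B := (n * (n * N ^ n))%N.
have B0 : (0 < B)%N by rewrite !muln_gt0 n0 expn_gt0 N0.
have Bp : (B < p)%N.
  apply: leq_ltn_trans resp; rewrite -/B; apply: leq_trans (leq_pmull _ (fact_gt0 _)).
  by rewrite -[X in (X <= _)%N]expn1 leq_pexp2l // muln_gt0.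
have szt (t : n.-tuple 'I_N) : (size (tnum k t) <= n.+1)%N.
  by have := size_tnum_le k t; rewrite size_tuple.
have coeft (t : n.-tuple 'I_N) i : `|(tnum k t)`_i| <= B%:Z.
  by have := coef_tnum_le k t i N0; rewrite size_tuple.
pose P0 : {poly algC} := map_poly intr (tnum k t0).
have P0nz : P0 != 0 by rewrite map_poly_eq0_id0 // intr_eq0 lead_coef_eq0.
have [rs Ers] := closed_field_poly_normal P0.
have lc0 : lead_coef P0 != 0 by rewrite lead_coef_eq0.
have szrs : (size rs <= n)%N.
  have : (size P0 <= n.+1)%N by apply: leq_trans (size_poly _ _) (szt t0).
  by rewrite Ers size_scale // size_prod_XsubC ltnS.
pose Y (i : 'I_(size rs)) := [set t in X | root (map_poly intr (tnum k t)) (nth 0 rs i)].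
apply: leq_trans (_ : size rs * c <= _)%N; last by rewrite leq_mul2r szrs orbT.
apply: leq_trans (card_bigcup_le (F := Y) (c := c) _).
  apply/subset_leq_card/subsetP => t tX.
  have [z z0 zt] : exists2 z : algC, root P0 z & root (map_poly intr (tnum k t)) z.
    (* A zero numerator shares every root of [P0]; comparing [tnum k t0] with itself shows that [P0]
       has one. *)
    have [t00|tn0] := eqVneq (tnum k t) 0; last first.
      by apply: (@common_root_algC p _ _ B n u) => //; exact: hX.
    have [z zz _] := @common_root_algC p _ _ B n u p_pr nz0 nz0 (szt t0) (szt t0)
      (coeft t0) (coeft t0) resp Bp (hX _ t0X) (hX _ t0X).
    by exists z => //; rewrite t00 rmorph0 root0.
  have zrs : z \in rs by move: z0; rewrite Ers rootZ // root_prod_XsubC.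
  have iz : (index z rs < size rs)%N by rewrite index_mem.
  by apply/bigcupP; exists (Ordinal iz) => //; rewrite inE tX /= nth_index.
move=> i; have [f [f1 sf hf]] := primitive_min_poly (nth 0 rs i).
have [g Eg] : exists g, tnum k t0 = f * g.
  by apply: hf; rewrite -/P0 Ers rootZ // root_prod_XsubC mem_nth.
have : (size f <= n.+1)%N.
  by apply: leq_trans (szt t0); apply: dvdp_leq => //; rewrite Eg dvdp_mulr.
move=> fn; apply: (key f) => //; first by rewrite sf.
by move=> t; rewrite inE => /andP[_]; apply: hf.
Qed.

(** * Intervals and the number of solutions *)

Lemma card_interval (p N : nat) (M : int) : prime p -> (N <= p)%N ->
  #|[set ((M + i.+1%:Z)%:~R : 'F_p) | i : 'I_N]| = N.
Proof.
move=> p_pr Np; rewrite card_imset ?card_ord // => i j /eqP.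
rewrite -subr_eq0 -intrB intr_Fp_eq0 // => pij.
apply/val_inj/eqP; apply: contraLR pij => /= nij.
have := ltn_ord i; have := ltn_ord j => jN iN.
by rewrite gtnNdvd //; lia.
Qed.

Lemma J2k_trivial (p k : nat) (I : {set 'F_p}) : (J2k k I <= #|I| ^ (k + k))%N.
Proof.
rewrite -[X in (_ <= _ ^ X)%N]card_ord -card_ffun_on.
by apply/subset_leq_card/subsetP => x; rewrite inE => /andP[].
Qed.

(** With [u = - (M + 1)] the element of offset [i] is [- (u - i)], so the equation is, up to a
    common sign, the one in [root_tnum]. *)
Lemma J2k_le_root_tuples (p k N : nat) (M : int) : prime p ->
  let I := [set ((M + i.+1%:Z)%:~R : 'F_p) | i : 'I_N] in 0 \notin I ->
  exists u : 'F_p, exists X : {set (k + k).-tuple 'I_N},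
    (forall t : (k + k).-tuple 'I_N, t \in X -> root (map_poly intr (tnum k t)) u) /\
    (J2k k I <= #|X|)%N.
Proof.
move=> p_pr I I0; pose u : 'F_p := (- (M + 1))%:~R.
pose e (i : 'I_N) : 'F_p := (M + i.+1%:Z)%:~R.
have ue (i : 'I_N) : u - (i : nat)%:R = - e i.
  rewrite -[(i : nat)%:R]/((i : nat)%:Z%:~R) -intrB -intrN.
  by congr (_%:~R); lia.
have e0 i : e i != 0 by apply: contraNneq I0 => <-; apply: imset_f.
exists u.
pose X := [set t : (k + k).-tuple 'I_N |
  \sum_(x <- take k t) (e x)^-1 == \sum_(x <- drop k t) (e x)^-1].
exists X; split => [t|].
  rewrite inE => /eqP Et; apply: root_tnum => [x|]; first by rewrite ue oppr_eq0.
  under eq_bigr => x _ do rewrite ue invrN.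
  under [RHS]eq_bigr => x _ do rewrite ue invrN.
  by rewrite !sumrN Et.
pose F (t : (k + k).-tuple 'I_N) : {ffun 'I_(k + k) -> 'F_p} := [ffun i => e (tnth t i)].
apply: leq_trans (leq_imset_card F (mem X)).
apply/subset_leq_card/subsetP => x; rewrite inE => /andP[/ffun_onP xI xE].
have /fin_all_exists[y yE] i : exists y, x i = e y.
  by have /imsetP[y _ ->] := xI i; exists y.
pose t := cat_tuple [tuple y (lshift k i) | i < k] [tuple y (rshift k i) | i < k].
have xF : x = F t.
  apply/ffunP => i; rewrite ffunE yE; congr (e _); case: (split_ordP i) => j ->.
    by rewrite tnth_lshift tnth_mktuple.
  by rewrite tnth_rshift tnth_mktuple.
apply/imsetP; exists t => //; rewrite inE.
rewrite take_size_cat ?size_tuple // drop_size_cat ?size_tuple //.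
rewrite !big_tuple; move: xE; congr (_ == _).
  by apply: eq_bigr => i _; rewrite tnth_mktuple yE.
by apply: eq_bigr => i _; rewrite tnth_mktuple yE.
Qed.

Local Open Scope nat_scope.

Lemma fact_leq_exp n : n`! <= n ^ n.
Proof.
elim: n => // n IH; rewrite factS expnS leq_mul2l /=.
by apply: leq_trans IH _; case: n => // n; rewrite leq_exp2r.
Qed.

(** Source of the constant 32. Since [2 k <= N ^ k] and [4 k <= N ^ (2 k)], the factorial is at most
    [N ^ (8 k^2)] and the other factor at most [N ^ (16 k^2)]. *)
Lemma resultant_threshold k N : 0 < k -> 1 < N ->
  (2 * (k + k))`! * ((k + k) * ((k + k) * N ^ (k + k))) ^ (2 * (k + k)) <=
  N ^ (32 * k ^ 2).
Proof.
move=> k0 N1; rewrite addnn -mul2n.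
have le2 : 2 * k <= 2 ^ k by elim: k k0 => // -[|k] // IH _; rewrite expnS; have := IH isT; lia.
have le4 : 2 * (2 * k) <= 2 ^ (2 * k).
  by rewrite mul2n -addnn addnn -mul2n; apply: leq_trans (_ : 2 ^ k * 2 ^ k <= _); [nia|rewrite -expnD addnn mul2n].
have N2 e : 2 ^ e <= N ^ e by case: e => // e; rewrite leq_exp2r.
apply: leq_trans (_ : (N ^ (2 * k)) ^ (4 * k) * (N ^ k * (N ^ k * N ^ (2 * k))) ^ (4 * k) <= _).
  have -> : 2 * (2 * k) = 4 * k by lia.
  apply: leq_mul.
    apply: leq_trans (fact_leq_exp _) _; rewrite leq_exp2r ?muln_gt0 //.
    by apply: leq_trans (N2 _); move: le4; rewrite mulnA.
  rewrite leq_exp2r ?muln_gt0 //.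
  by rewrite !leq_mul // (leq_trans le2).
rewrite -!expnD -!expnM -expnD leq_exp2l //; nia.
Qed.

Lemma divisor_level_bound m : 0 < m -> exists2 C, 0 < C & forall L, 0 < L ->
  exists tau, [/\ 1 < tau, forall x, 0 < x <= L -> size (divisors x) < tau &
    tau ^ m <= C * L].
Proof.
move=> m0; have [C C0 HC] := size_divisors_bound m.
exists (3 ^ m * C); first by rewrite muln_gt0 expn_gt0.
move=> L L0; pose F (i : 'I_L) := size (divisors i.+1).
have LI : 0 < #|'I_L| by rewrite card_ord.
(* Adding 2 gives [1 < tau] and the strict bound; since the maximum is at least 1, it costs only a
   factor 3. *)
have [i0 Ei0] := bigop.eq_bigmax F LI; exists (\max_i F i + 2); split.
- by rewrite addn2.
- move=> x /andP[x0 xL]; have xL' : x.-1 < L by lia.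
  have : F (Ordinal xL') <= \max_i F i by apply: (bigop.leq_bigmax (F := F)).
  by rewrite /F /= prednK //; lia.
rewrite Ei0; have F1 : 0 < F i0.
  by rewrite /F; have := divisors_id (ltn0Sn i0); case: (divisors _).
apply: leq_trans (_ : (3 * F i0) ^ m <= _); first by rewrite leq_exp2r //; lia.
rewrite expnMn -mulnA leq_mul2l; apply/orP; right.
by apply: leq_trans (HC _ _) _ => //; rewrite leq_mul2l ltn_ord orbT.
Qed.

(** An [m]-th power keeps all exponents integral. The loss [tau ^ (n n)] has [m]-th power at most
    [(C n N ^ n) ^ (n n)], which yields [N ^ (n ^ 3) = N ^ (8 k ^ 3)] independently of [m]. *)
Lemma J2k_power_bound k m : 0 < k -> 0 < m -> exists2 K, 0 < K &
  forall (p N : nat) (M : int), prime p ->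
  let I := [set ((M + i.+1%:Z)%:~R : 'F_p)%R | i : 'I_N] in (0 \notin I)%R ->
  0 < N <= p -> N ^ (32 * k ^ 2) < p ->
  J2k k I ^ m <= K * N ^ (k * m + 8 * k ^ 3).
Proof.
move=> k0 m0; have [C C0 HC] := divisor_level_bound m0.
set n := k + k; have n0 : 0 < n by rewrite /n; lia.
(* The factor [4 ^ k] comes from [(2 ^ h) ^ n = (4 ^ h) ^ k <= (4 N) ^ k]. *)
pose A := n * (2 * (18 * n) ^ n * 4 ^ k).
pose K := A ^ m * (C * n) ^ (n * n).
have A0 : 0 < A by rewrite !muln_gt0 n0 !expn_gt0 /= muln_gt0 n0.
have K0 : 0 < K by rewrite muln_gt0 !expn_gt0 A0 muln_gt0 C0 n0.
exists K => // p N M p_pr I I0 /andP[N0 Np] Nkp.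
have [N1|N_gt1] := leqP N 1.
  have EN : N = 1 by lia.
  have := J2k_trivial k I; rewrite /I card_interval // EN exp1n => J1.
  rewrite !exp1n muln1; apply: leq_trans (_ : 1 ^ m <= _); last by rewrite exp1n.
  by rewrite leq_exp2r.
have [u [X [Xroot JX]]] := J2k_le_root_tuples k p_pr I0.
have L0 : 0 < n * N ^ n by rewrite muln_gt0 n0 expn_gt0 N0.
have [tau [tau1 htau taum]] := HC _ L0.
pose h := up_log 4 N.
have Nh : N <= 4 ^ h by apply: up_logP.
have hN : 4 ^ h <= 4 * N.
  have := @up_log_gtn 4 N isT N_gt1; rewrite -/h.
  have : 0 < h by rewrite up_log_gt0.
  by case: (h) => // h' _ /=; rewrite expnS; lia.
have J1 : J2k k I <= A * tau ^ (n * n) * N ^ k.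
  apply: leq_trans JX _; apply: leq_trans (card_root_tuples (h := h) p_pr n0 _ tau1 htau _ Xroot) _.
  - by rewrite N0 Nh.
  - exact: leq_ltn_trans (resultant_threshold k0 N_gt1) Nkp.
  have E : (2 ^ h) ^ n = (4 ^ h) ^ k by rewrite /n expnD -expnMn -expnMn.
  rewrite E [(tau ^ n * _) ^ n]expnMn -expnM /A.
  have : (4 ^ h) ^ k <= 4 ^ k * N ^ k by rewrite -expnMn leq_exp2r.
  move: (tau ^ _) ((18 * n) ^ n) ((4 ^ h) ^ k) (4 ^ k) (N ^ k) => a b c d e le.
  by rewrite (_ : n * (2 * b * d) * a * e = n * (2 * (a * b) * (d * e))) ?leq_mul //; lia.
apply: leq_trans (_ : (A * tau ^ (n * n) * N ^ k) ^ m <= _); first by rewrite leq_exp2r.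
have -> : (A * tau ^ (n * n) * N ^ k) ^ m = A ^ m * (tau ^ m) ^ (n * n) * N ^ (k * m).
  by rewrite (expnMn (A * _)) (expnMn A) -!expnM (mulnC m).
rewrite expnD.
have : (tau ^ m) ^ (n * n) <= (C * n) ^ (n * n) * N ^ (8 * k ^ 3).
  have -> : 8 * k ^ 3 = n * (n * n) by rewrite /n; lia.
  by rewrite (expnM N) -(expnMn (C * n)) leq_exp2r ?muln_gt0 ?n0 // -mulnA.
rewrite /K; move: ((tau ^ m) ^ _) (A ^ m) (N ^ (k * m)) ((C * n) ^ _) (N ^ _) => a b c d e le.
by rewrite (_ : b * d * (c * e) = b * (d * e) * c) ?leq_mul //; lia.
Qed.

(** Cauchy-Schwarz for the fibre sizes [r s]: their sum is [#|A|], and the sum of their squares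
    counts the collisions. *)
Lemma sqr_card_le_collisions (T U : finType) (f : T -> U) (A : {set T}) :
  #|A| ^ 2 <= #|f @: A| * #|[set z in setX A A | f z.1 == f z.2]|.
Proof.
pose r s := #|[set x in A | f x == s]|.
have sumr : #|A| = \sum_(s in f @: A) r s.
  rewrite -sum1_card (partition_big f (mem (f @: A))) /=; last by move=> x xA; apply: imset_f.
  by apply: eq_bigr => s _; rewrite sum1dep_card; apply: eq_card => x; rewrite !inE.
have -> : #|[set z in setX A A | f z.1 == f z.2]| = \sum_(s in f @: A) r s ^ 2.
  rewrite -sum1_card (partition_big (fun z => f z.1) (mem (f @: A))) /=; last first.
    by move=> z; rewrite !inE => /andP[/andP[zA _] _]; apply: imset_f.
  apply: eq_bigr => s _; rewrite sum1dep_card -mulnn -cardsX.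
  apply: eq_card => z; rewrite !inE.
  case: (f z.1 =P s) => [->|_]; last by rewrite !andbF.
  by rewrite !andbT eq_sym andbA.
rewrite -(leq_pmul2l (ltn0Sn 1)) sumr -mulnn big_distrlr /= big_distrr /=.
under eq_bigr => s _ do rewrite big_distrr /=.
apply: leq_trans (_ : \sum_(s in f @: A) \sum_(s' in f @: A) (r s ^ 2 + r s' ^ 2) <= _).
  by apply: leq_sum => s _; apply: leq_sum => s' _; apply: nat_Cauchy.
under eq_bigr => s _ do rewrite big_split /= sum_nat_const.
by rewrite big_split /= -big_distrr /= sum_nat_const mul2n addnn.
Qed.

(** Concatenating two [k]-tuples with equal sums of inverses gives a solution, so the collisions
    inject into the solutions. *)
Lemma inv_sumset_J2k (p k : nat) (I : {set 'F_p}) :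
  #|I| ^ (k + k) <= #|inv_sumset k I| * J2k k I.
Proof.
pose A : {set {ffun 'I_k -> 'F_p}} := [set x in ffun_on (mem I)].
pose f (x : {ffun 'I_k -> 'F_p}) := (\sum_(i < k) (x i)^-1)%R.
have cA : #|A| = #|I| ^ k by rewrite cardsE card_ffun_on card_ord.
have -> : inv_sumset k I = f @: A.
  by apply/setP => s; apply/imsetP/imsetP => -[x xA ->]; exists x; move: xA; rewrite ?inE.
rewrite expnD -cA mulnn; apply: leq_trans (sqr_card_le_collisions f A) _.
rewrite leq_mul2l; apply/orP; right.
pose F (z : {ffun 'I_k -> 'F_p} * {ffun 'I_k -> 'F_p}) : {ffun 'I_(k + k) -> 'F_p} :=
  [ffun i => match split i with inl j => z.1 j | inr j => z.2 j end].
have Fl z j : F z (lshift k j) = z.1 j by rewrite ffunE (unsplitK (inl j)).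
have Fr z j : F z (rshift k j) = z.2 j by rewrite ffunE (unsplitK (inr j)).
have Finj : injective F.
  move=> [a b] [a' b'] /ffunP E; congr pair; apply/ffunP => j.
    by have := E (lshift k j); rewrite !Fl.
  by have := E (rshift k j); rewrite !Fr.
rewrite -(card_imset _ Finj); apply/subset_leq_card/subsetP => _ /imsetP[z + ->].
rewrite !inE => /andP[/andP[/ffun_onP z1 /ffun_onP z2] zE]; apply/andP; split.
  by apply/ffun_onP => i; case: (split_ordP i) => j ->; rewrite ?Fl ?Fr.
by under eq_bigr => i _ do rewrite Fl; under [X in _ == X]eq_bigr => i _ do rewrite Fr.
Qed.

Local Open Scope ring_scope.

Theorem theorem4 (R : realType) :
  exists2 c : R, 0 < c &
    forall (k : nat) (eps : R), (0 < k)%N -> 0 < eps ->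
      exists C C' : R, [/\ 0 < C, 0 < C' &
        forall (p : nat) (I : {set 'F_p}),
          prime p -> Fp_interval I -> 0 \notin I ->
          #|I|%:R < p%:R `^ (c / k%:R ^+ 2) ->
          (J2k k I)%:R < C * #|I|%:R `^ (k%:R + eps) /\
          C' * #|I|%:R `^ (k%:R - eps) < #|inv_sumset k I|%:R].
Proof.
exists 32^-1; first by rewrite invr_gt0.
(* With this [m], the excess exponent [8 k ^ 3] of the [m]-th power bound is at most [eps m]. *)
move=> k eps k0 eps0; set m := (Num.bound ((8 * k ^ 3)%:R / eps)).+1.
have m0 : (0 < m)%N by [].
have hm : (8 * k ^ 3)%:R <= eps * m%:R.
  rewrite -ler_pdivrMl // mulrC ltW //; apply: lt_trans (archi_boundP _) _.
    by rewrite divr_ge0 // ltW.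
  by rewrite ltr_nat.
have [K K0 HK] := @J2k_power_bound k m k0 m0.
have C0 : 0 < K%:R + 1 :> R by rewrite ltr_wpDl.
exists (K%:R + 1), (K%:R + 1)^-1; split => //; first by rewrite invr_gt0.
move=> p I p_pr [M [N [/andP[N0 Np] EI]]] I0.
have cI : #|I| = N by rewrite EI card_interval.
rewrite cI => hN; rewrite EI in I0.
have N0' : 0 < N%:R :> R by rewrite ltr0n.
have N1 : 1 <= N%:R :> R by rewrite ler1n.
have Nkp : (N ^ (32 * k ^ 2) < p)%N.
  have e0 : (32 * k ^ 2 != 0)%N by rewrite -lt0n muln_gt0 expn_gt0 k0.
  rewrite -(ltr_nat R) natrX; apply: lt_le_trans (_ : (p%:R `^ (32^-1 / k%:R ^+ 2)) ^+ (32 * k ^ 2) <= _).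
    by rewrite ltrXn2r // ltW.
  rewrite -powR_mulrn ?powR_ge0 // -powRrM natrM natrX.
  have -> : 32^-1 / k%:R ^+ 2 * (32%:R * k%:R ^+ 2) = 1 :> R.
    by field; rewrite pnatr_eq0 -lt0n k0.
  by rewrite powRr1.
have JK := HK p N M p_pr I0 _ Nkp; rewrite N0 Np -EI in JK; have {}JK := JK isT.
(* The 1 added to [K] makes the inequality strict. The weak one follows by comparing [m]-th powers,
   with [K <= K ^ m]. *)
have J_lt : (J2k k I)%:R < (K%:R + 1) * N%:R `^ (k%:R + eps) :> R.
  apply: le_lt_trans (_ : K%:R * N%:R `^ (k%:R + eps) < _); last first.
    by rewrite ltr_pM2r ?powR_gt0 // ltrDl.
  rewrite -(ler_pXn2r m0) ?nnegrE ?mulr_ge0 ?powR_ge0 //.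
  rewrite exprMn -[(_ `^ _) ^+ m]powR_mulrn ?powR_ge0 // -powRrM.
  apply: le_trans (_ : K%:R * N%:R `^ (k * m + 8 * k ^ 3)%:R <= _).
    by rewrite (powR_mulrn _ (ltW N0')) -!natrX -natrM ler_nat; exact: JK.
  apply: ler_pM; rewrite ?powR_ge0 //.
    by rewrite ler_eXnr ?ler1n.
  by rewrite ler_powR // natrD mulrDl natrM lerD2l.
split => //.
have := inv_sumset_J2k k I; rewrite cI => CS.
have S0 : 0 < #|inv_sumset k I|%:R :> R.
  rewrite ltr0n lt0n; apply: contraTneq CS => ->.
  by rewrite mul0n leqn0 -lt0n expn_gt0 N0.
have : N%:R `^ (k%:R + k%:R) < #|inv_sumset k I|%:R * ((K%:R + 1) * N%:R `^ (k%:R + eps)).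
  rewrite -natrD (powR_mulrn _ (ltW N0')) -natrX.
  apply: le_lt_trans (_ : (#|inv_sumset k I| * J2k k I)%:R < _); first by rewrite ler_nat.
  by rewrite natrM ltr_pM2l.
have -> : k%:R + k%:R = (k%:R - eps) + (k%:R + eps) :> R by ring.
rewrite powRD; last by rewrite lt0r_neq0 ?implybT.
by rewrite mulrA ltr_pM2r ?powR_gt0 // => h; rewrite mulrC ltr_pdivrMr.
Qed.
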